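(* Let $G$ be a finitely generated group. Then there exist a finite alphabet $A$ and a non-empty $G$-subshift $X\subseteq A^G$ that is $G$-effectively closed and strongly aperiodic.
   Context: For a finite alphabet $A$, $A^G$ carries the product topology ($A$ discrete) and the shift action $(\sigma_g(x))_h=x_{g^{-1}h}$. A $G$-subshift is a closed, shift-invariant subset of $A^G$. A pattern with finite support $F\subset G$ is an element $p\in A^F$; it appears in $x\in A^G$ if there is $g\in G$ with $x_{gh}=p_h$ for all $h\in F$. For a set $\mathcal{F}$ of patterns, $X_{\mathcal F}$ is the set of $x\in A^G$ in which no $p\in\mathcal F$ appears; subshifts are exactly the sets of the form $X_{\mathcal F}$. A subshift $X$ is strongly aperiodic if for every $x\in X$, $\{g\in G\mid\sigma_g(x)=x\}=\{1_G\}$. Let $S$ be a finite generating set of $G$. For words $w,w'\in(S\cup S^{-1})^*$ write $w=_G w'$ if they represent the same element of $G$, and let $\mathtt{WP}(G)=\{w\in(S\cup S^{-1})^*\mid w=_G1_G\}$. A pattern coding is a finite set of tuples $c=(w_i,a_i)_{1\le i\le n}$ with $w_i\in(S\cup S^{-1})^*$ and $a_i\in A$. It is consistent if $w_i=_Gw_j$ implies $a_i=a_j$. A consistent pattern coding $c$ codifies a pattern $P$ with support $F$ if every $w_i$ represents an element of $F$ and for every $g\in F$ there is a tuple $(w_i,a_i)\in c$ with $g=_Gw_i$ and $P_g=a_i$. A subshift $X\subseteq A^G$ is $G$-effectively closed if there is a Turing machine with oracle $\mathtt{WP}(G)$ which recognizes (i.e. semi-decides) a set of pattern codings such that the consistent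 ones in this set codify a set of patterns $\mathcal F$ with $X=X_{\mathcal F}$. *)

(* Defs.v *)
From mathcomp Require Import all_boot.
From mathcomp Require Import finmap.
From mathcomp Require Import boolp classical_sets topology.

Set Implicit Arguments.
Unset Strict Implicit.
Unset Printing Implicit Defensive.

Local Open Scope group_scope.
Local Open Scope fmap_scope.
Local Open Scope classical_set_scope.

(* [groupType] is the type of arbitrary, possibly infinite, groups. *)

Section Subshifts.
Variables (G : groupType) (A : finType).

(* A^G with the product topology, A being discrete. *)
Definition full_shift : topologicalType := {ptws G -> discrete_topology A}.

Definition shift_action (g : G) (x : full_shift) : full_shift :=
  fun h => x (g^-1 * h).

Definition is_subshift (X : set full_shift) : Prop :=
  closed X /\ forall g, shift_action g @` X `<=` X.

Definition strongly_aperiodic (X : set full_shift) : Prop :=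
  forall x, X x -> [set g | shift_action g x = x] = [set 1].

(* A pattern is a finite map; its support is its domain. *)
Definition pattern : Type := {fmap G -> A}.

Definition appears (p : pattern) (x : full_shift) : Prop :=
  exists g : G, forall h : domf p, x (g * val h) = p h.

Definition avoiding (F : set pattern) : set full_shift :=
  [set x | forall p, F p -> ~ appears p x].

End Subshifts.

Section Words.
Variables (G : groupType) (S : {fset G}).

(* The symbols of S u S^-1, as a finite type. *)
Definition letter : finType := (S `|` [fset x^-1 | x in S])%fset.

Definition word : Type := seq letter.

Definition word_value (w : word) : G := \prod_(s <- w) val s.

Definition generates : Prop := forall g : G, exists w : word, word_value w = g.

Definition word_problem : set word := [set w | word_value w = 1].

End Words.

(* Deterministic multitape Turing machines with an oracle.  The tape alphabet
   consists of the blank [None], the input symbols and auxiliary symbols.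
   There are [extra_tapes.+1] tapes, infinite in both directions: tape [ord0]
   receives the input and tape [ord_max] is the oracle tape. *)

Inductive direction := ToLeft | Stay | ToRight.

Section OracleMachines.
Variable Sigma : finType.

Record oracle_machine : Type := OracleMachine {
  state : finType;
  aux_symbol : finType;
  extra_tapes : nat;
  start_state : state;
  accept_state : state;
  query_state : state;
  yes_state : state;
  no_state : state;
  transition : state ->
    {ffun 'I_extra_tapes.+1 -> option (Sigma + aux_symbol)} ->
    state *
    {ffun 'I_extra_tapes.+1 -> option (Sigma + aux_symbol) * direction}
}.

Section Run.
Variable M : oracle_machine.

Definition symbol : Type := option (Sigma + aux_symbol M).

(* [on_left] lists the cells to the left of the head, nearest first, and
   [on_right] those to its right; the cells not listed are blank. *)
Record tape : Type :=
  Tape { on_left : seq symbol; scanned : symbol; on_right : seq symbol }.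

Definition tape_of (s : seq symbol) : tape :=
  Tape [::] (head None s) (behead s).

Definition write_and_move (t : tape) (a : symbol * direction) : tape :=
  let: Tape l _ r := t in
  match a.2 with
  | ToLeft => Tape (behead l) (head None l) (a.1 :: r)
  | Stay => Tape l a.1 r
  | ToRight => Tape (a.1 :: l) (head None r) (behead r)
  end.

Fixpoint input_prefix (s : seq symbol) : seq Sigma :=
  if s is Some (inl a) :: s' then a :: input_prefix s' else [::].

(* The queried word starts in the scanned cell of the oracle tape and extends
   to the right, up to the first cell not containing an input symbol. *)
Definition queried_word (t : tape) : seq Sigma :=
  input_prefix (scanned t :: on_right t).

Definition configuration : Type :=
  state M * {ffun 'I_(extra_tapes M).+1 -> tape}.

Definition initial (u : seq Sigma) : configuration :=
  (start_state M,
   [ffun i => if i == ord0 then tape_of [seq Some (inl a) | a <- u]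
              else tape_of [::]]).

Definition step (O : set (seq Sigma)) (c : configuration) : configuration :=
  let: (q, ts) := c in
  if q == query_state M then
    (if `[< O (queried_word (ts ord_max)) >] then yes_state M else no_state M,
     ts)
  else
    let: (q', act) := transition q [ffun i => scanned (ts i)] in
    (q', [ffun i => write_and_move (ts i) (act i)]).

Definition accepts (O : set (seq Sigma)) (u : seq Sigma) : Prop :=
  exists n, (iter n (step O) (initial u)).1 = accept_state M.

End Run.

End OracleMachines.

Section EffectivelyClosed.
Variables (G : groupType) (S : {fset G}) (A : finType).

Definition pattern_coding : Type := seq (word S * A).

Definition consistent (c : pattern_coding) : Prop :=
  forall t u, t \in c -> u \in c -> word_value t.1 = word_value u.1 ->
  t.2 = u.2.

Definition codifies (c : pattern_coding) (P : pattern G A) : Prop :=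
  (forall t, t \in c -> word_value t.1 \in domf P) /\
  (forall g : domf P, exists2 t, t \in c &
     val g = word_value t.1 /\ P g = t.2).

(* The coding (w_1,a_1), ..., (w_n,a_n) is written w_1 a_1 ... w_n a_n over
   the disjoint union of the letters and of A, which is uniquely decodable. *)
Definition encode (c : pattern_coding) : seq (letter S + A)%type :=
  flatten [seq rcons [seq inl s | s <- t.1] (inr t.2) | t <- c].

Definition wp_oracle : set (seq (letter S + A)%type) :=
  [set [seq inl s | s <- w] | w in @word_problem G S].

Definition recognizes (M : oracle_machine (letter S + A)%type)
    (C : set pattern_coding) : Prop :=
  forall c, C c <-> accepts M wp_oracle (encode c).

Definition codified_patterns (C : set pattern_coding) : set (pattern G A) :=
  [set P | exists c, [/\ C c, consistent c & codifies c P]].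

Definition effectively_closed (X : set (full_shift G A)) : Prop :=
  exists (M : oracle_machine (letter S + A)%type) (C : set pattern_coding),
    recognizes M C /\ X = avoiding (codified_patterns C).

End EffectivelyClosed.

(* Main.v *)
(** Call a word w with w <>_G 1 repeated at k in a colouring x when
    x(k p) = x(k w p) for every proper prefix p of w.  A colouring without any
    such repetition is not fixed by any g <> 1: for a word w representing g,
    take k = 1.

    If two of the points k p, k w p coincide, then cutting w or passing to a
    factor of w gives a shorter word whose repetition is implied by that of w.
    So it suffices to avoid repetitions along words w for which these 2 |w|
    points are distinct.  Colourings of finite sets avoiding them exist by
    Rosenfeld's counting argument (each new vertex multiplies the number of
    good colourings by a constant factor) and then, by compactness, so does a
    colouring of G.

    No distinctness has to be tested by the machine, which makes it simple: it
    reads [::], v, s_1, v s_1, s_1 s_2, v s_1 s_2, ... with colours, both words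
    of each pair having the same colour, asks the oracle whether v = 1
    (rejecting if so), and accepts as soon as v s_1 ... s_n = 1. *)

From HB Require Import structures.
Require Import Defs.
From mathcomp Require Import all_boot finmap boolp classical_sets topology.
From mathcomp Require Import cardinality zify.
Set Implicit Arguments.
Unset Strict Implicit.
Unset Printing Implicit Defensive.

(** * Colouring by counting *)

(** A geometric series without division: after the first term, the induction hypothesis applies to
    the sequence [2 * b n.+1] with the same M. *)
Lemma sum_halving (b : nat -> nat) (M m : nat) :
  (forall n, 2 ^ n * b n <= M) -> \sum_(n < m) b n <= 2 * M.
Proof.
elim: m b => [|m IHm] b b_le; first by rewrite big_ord0.
rewrite big_ord_recl /= mul2n -addnn leq_add //.
  by have := b_le 0; rewrite mul1n.
rewrite -(leq_pmul2l (isT : 0 < 2)) big_distrr /=.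
by apply: (IHm (fun n => 2 * b n.+1)) => n; rewrite mulnA -expnSr.
Qed.

Lemma card_bigcup_seq (I : Type) (T : finType) (r : seq I) (F : I -> {set T}) :
  #|\bigcup_(i <- r) F i| <= \sum_(i <- r) #|F i|.
Proof.
elim/big_rec2: _ => [|i n B _ le_Bn]; first by rewrite cards0.
by rewrite (leq_trans (leq_card_setU _ _)) // leq_add2l.
Qed.

Lemma mem_bigcup_seq (I : eqType) (T : finType) (r : seq I) (F : I -> {set T})
  i x : i \in r -> x \in F i -> x \in \bigcup_(j <- r) F j.
Proof.
elim: r => //= j r IHr; rewrite big_cons !inE => /orP[/eqP <- -> // | ir xi].
by rewrite IHr ?orbT.
Qed.

Section PairSequences.
Variable T : eqType.
Implicit Type e : seq (T * T).

Definition points e : seq T := unzip1 e ++ unzip2 e.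

(** Swapping allows a given point to be taken always among the first components. *)
Definition flip e : seq (T * T) := [seq (ab.2, ab.1) | ab <- e].

Lemma unzip_flip e :
  (unzip1 (flip e) = unzip2 e) * (unzip2 (flip e) = unzip1 e).
Proof. by split; rewrite /unzip1 /unzip2 -map_comp. Qed.

Definition repeated (B : eqType) (h : T -> B) e : bool :=
  all (fun ab => h ab.1 == h ab.2) e.

Lemma repeated_flip (B : eqType) (h : T -> B) e :
  repeated h (flip e) = repeated h e.
Proof. by rewrite /repeated all_map; apply: eq_all => ab /=; rewrite eq_sym. Qed.

Lemma repeated_subset (B : eqType) (P : {pred T}) (f h : T -> B) e :
  {subset points e <= P} -> {in P, f =1 h} -> repeated f e = repeated h e.
Proof.
move=> eP fh; apply: eq_in_all => -[a b] /= ab.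
have aP : a \in P by apply: eP; rewrite mem_cat (map_f fst ab).
have bP : b \in P by apply: eP; rewrite mem_cat (map_f snd ab) orbT.
by rewrite !fh.
Qed.

End PairSequences.

(** * Rosenfeld's counting argument on a finite set *)

Section Rosenfeld.
Variables (T : finType) (k : nat) (constraint : seq (T * T) -> Prop).
(** Lists the constraints of size n.+1 through v, flipped if necessary to make v a first component.
    Other sequences may be listed too, so [violations] tests the shape of e itself. *)
Variable constraints_at : nat -> T -> seq (seq (T * T)).

Hypothesis constraint_neq0 : forall e, constraint e -> 0 < size e.
Hypothesis constraint_uniq : forall e, constraint e -> uniq (points e).
Hypothesis mem_constraints_at1 : forall e v,
  constraint e -> v \in unzip1 e -> e \in constraints_at (size e).-1 v.
Hypothesis mem_constraints_at2 : forall e v,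
  constraint e -> v \in unzip2 e -> flip e \in constraints_at (size e).-1 v.
Hypothesis size_constraints_at : forall n v,
  size (constraints_at n v) <= 2 * n.+1 * k ^ n.+1.

Local Notation color := 'I_(8 * k).+1.
Implicit Types (f h : {ffun T -> color}) (U W : {set T}).

Definition good U f : bool :=
  `[< forall e, constraint e -> {subset points e <= U} -> ~~ repeated f e >].

(* A colouring of U is extended by [ord0] to all of T. *)
Definition good_colorings U : {set {ffun T -> color}} :=
  [set f : {ffun T -> color} |
    [forall t, (t \notin U) ==> (f t == ord0)] && good U f].

Lemma good_coloringsP U f :
  reflect ((forall t, t \notin U -> f t = ord0) /\
           (forall e, constraint e -> {subset points e <= U} -> ~~ repeated f e))
          (f \in good_colorings U).
Proof.
rewrite inE; apply: (iffP andP) => -[f0 gf]; split.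
- by move=> t tU; apply/eqP; move/forallP/(_ t)/implyP: f0; apply.
- exact/asboolP.
- by apply/forallP => t; apply/implyP => tU; rewrite f0.
- exact/asboolP.
Qed.

Definition erase (P : pred T) f : {ffun T -> color} :=
  [ffun t => if P t then ord0 else f t].

Lemma erase_good U (s : {set T}) (f : {ffun T -> color}) :
  f \in good_colorings U -> erase (mem s) f \in good_colorings (U :\: s).
Proof.
case/good_coloringsP => f0 gf; apply/good_coloringsP; split=> [t|e Ce eU].
  rewrite inE negb_and negbK ffunE /=; case: (t \in s) => //= tU; exact: f0.
rewrite (@repeated_subset _ _ (mem (U :\: s)) _ f e eU) ?gf // => t.
  by move/eU; rewrite inE => /andP[].
by rewrite ffunE [in X in X -> _]inE => /= /andP[/negPf ->].
Qed.

(** The points of [U :&: W] are removed one at a time, each removal dividing the count by at least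
    4k+1. The bound m lets the growth hypothesis be the induction hypothesis of
    [card_good_coloringsU1]. *)
Lemma card_erased U W m :
    (forall U' v, #|U'| < m -> v \notin U' ->
       (4 * k).+1 * #|good_colorings U'| <= #|good_colorings (v |: U')|) ->
  #|U| <= m ->
  (4 * k).+1 ^ #|U :&: W| * #|good_colorings (U :\: W)| <= #|good_colorings U|.
Proof.
move=> IH; move En: #|U :&: W| => n.
elim: n U En => [|n IHn] U En Um.
  rewrite mul1n; suff -> : U :\: W = U by [].
  by apply/finset.setDidPl; rewrite -setI_eq0 -cards_eq0 En.
have /card_gt0P[w] : 0 < #|U :&: W| by rewrite En.
rewrite inE => /andP[wU wW].
have Uw : #|U :\ w| < #|U| by rewrite [#|U|](cardsD1 w) wU.
have := IH (U :\ w) w (leq_trans Uw Um).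
rewrite finset.setD11 finset.setD1K // => /(_ isT).
apply: leq_trans; rewrite expnS -mulnA leq_mul2l /=.
have <- : (U :\ w) :\: W = U :\: W.
  by apply/finset.setP=> t; rewrite !inE; case: eqP => // ->; rewrite wW.
apply: IHn; last exact: leq_trans (ltnW Uw) Um.
apply/eqP; rewrite -eqSS -En [#|U :&: W|](cardsD1 w) inE wU wW /= add1n eqSS.
by apply/eqP; congr #|pred_of_set _|; apply/finset.setP => t; rewrite !inE andbA.
Qed.

Definition recolor f v (a : color) : {ffun T -> color} :=
  [ffun t => if t == v then a else f t].

Definition one_vertex_extensions U v : {set {ffun T -> color}} :=
  [set recolor p.1 v p.2 | p in finset.setX (good_colorings U) [set: color]%SET].

Lemma card_one_vertex_extensions U v : v \notin U ->
  #|one_vertex_extensions U v| = (8 * k).+1 * #|good_colorings U|.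
Proof.
move=> vU; rewrite card_in_imset ?cardsX ?cardsT ?card_ord 1?mulnC //.
(* The value overwritten at v is [ord0] for every good colouring of U, so recolouring is
   injective. *)
move=> [f a] [h b] /finset.setXP[/good_coloringsP[f0 _] _].
move=> /finset.setXP[/good_coloringsP[h0 _] _] /ffunP /= eq_fh.
congr pair; last by have := eq_fh v; rewrite !ffunE eqxx.
apply/ffunP=> t; have := eq_fh t; rewrite !ffunE; case: eqP => // ->.
by rewrite f0 // h0.
Qed.

Definition violations U v n (e : seq (T * T)) : {set {ffun T -> color}} :=
  [set h in one_vertex_extensions U v |
    [&& repeated h e, size e == n.+1, uniq (points e), v \in unzip1 e
      & all (mem (v |: U)) (points e)]].

(* A colouring repeated along e is determined by its values outside
   [unzip1 e], which contains v. *)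
Lemma card_violations U v n e : v \notin U ->
    (forall U' v, #|U'| < #|U| -> v \notin U' ->
       (4 * k).+1 * #|good_colorings U'| <= #|good_colorings (v |: U')|) ->
  (4 * k).+1 ^ n * #|violations U v n e| <= #|good_colorings U|.
Proof.
(* The shape of e is recorded in [violations], so a single member h0 provides it. *)
move=> vU IH; have [->|[h0 h0e]] := set_0Vmem (violations U v n e).
  by rewrite cards0 muln0.
move: h0e; rewrite inE => /and5P[_ _ /eqP size_e Ue /andP[ve /allP eU]].
pose W := [set t in unzip1 e].
apply: leq_trans (card_erased W IH (leqnn _)).
(* W has n+1 points, and all of them except v lie in U. *)
have -> : #|U :&: W| = n.
  have -> : U :&: W = W :\ v.
    apply/finset.setP => t; rewrite !inE; case: eqP => [->|/eqP tv] /=.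
      by rewrite (negPf vU).
    apply: andb_idl => te; have := eU t; rewrite mem_cat te => /(_ isT).
    by rewrite /= !inE (negPf tv).
  apply/eqP; rewrite -eqSS -size_e -(size_map fst e) -[X in X == _]add1n.
  have <- : (v \in W) = 1 :> nat by rewrite inE ve.
  rewrite -(cardsD1 v) cardsE; apply/eqP/card_uniqP.
  by move: Ue; rewrite cat_uniq => /andP[].
rewrite leq_mul2l; apply/orP; right.
rewrite -(@card_in_imset _ _ (erase (mem W))); last first.
  move=> f h; rewrite !inE => /and3P[_ rf _] /and3P[_ rh _] /ffunP eq_fh.
  have eq2 t : t \notin W -> f t = h t.
    by move=> tW; have := eq_fh t; rewrite !ffunE /= (negPf tW).
  apply/ffunP => t; case: (boolP (t \in W)) => [|/eq2 //].
  rewrite inE => /mapP[[a b] ab ->] /=.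
  rewrite (eqP (allP rf _ ab)) (eqP (allP rh _ ab)) /= eq2 // inE.
  move: Ue; rewrite cat_uniq => /and3P[_ /hasPn dis _].
  by apply: dis; rewrite (map_f snd ab).
apply: subset_leq_card; apply/fintype.subsetP => _ /imsetP[h he ->].
move: he; rewrite inE => /andP[/imsetP[[f a] /finset.setXP[fU _] /= ->] _].
(* Since v is in W, erasing W also forgets the new colour of v. *)
suff -> : erase (mem W) (recolor f v a) = erase (mem W) f by exact: erase_good.
apply/ffunP => t; rewrite !ffunE /=; case: (boolP (t \in W)) => // tW.
by case: eqP tW => // ->; rewrite inE ve.
Qed.

(** An extension that is not good violates a constraint, and this one passes through v because those
    inside U are already respected. Its points are distinct, which bounds its size by [#|T|]. *)
Lemma one_vertex_extensions_sub U v : v \notin U ->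
  one_vertex_extensions U v \subset good_colorings (v |: U) :|:
    \bigcup_(n < #|T|) \bigcup_(e <- constraints_at n v) violations U v n e.
Proof.
move=> vU; apply/fintype.subsetP => h hE; rewrite inE; apply/orP.
have [|hbad] := boolP (h \in good_colorings (v |: U)); first by left.
right; case/imsetP: (hE) => -[f a] /finset.setXP[fU _] hfa.
have /good_coloringsP[f0 gf] := fU.
have hU t : t \in U -> h t = f t.
  by move=> tU; rewrite hfa ffunE; case: eqP => // tv; rewrite -tv tU in vU.
have h0 t : t \notin v |: U -> h t = ord0.
  by rewrite hfa ffunE !inE negb_or => /andP[/negPf -> /f0].
have : ~ forall e, constraint e -> {subset points e <= v |: U} -> ~~ repeated h e.
  by move=> gh; move/good_coloringsP: hbad; case.
move=> /existsNP[e] /not_implyP[Ce] /not_implyP[eU] /negP; rewrite negbK => rh.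
have ve : v \in points e.
  apply/negPn/negP => ve; have eU' : {subset points e <= U}.
    move=> t te; have := eU t te; rewrite !inE => /orP[/eqP tv|//].
    by rewrite -tv te in ve.
  have /negP := gf e Ce eU'; apply.
  by rewrite -(@repeated_subset _ _ (mem U) h f) // => t /hU.
have size_e := constraint_neq0 Ce; have Ue := constraint_uniq Ce.
have lt_eT : (size e).-1 < #|T|.
  rewrite prednK //; have := card_uniqP Ue; rewrite size_cat !size_map => pe.
  by rewrite (leq_trans (leq_addr (size e) _)) // -pe max_card.
apply/bigcupP; exists (Ordinal lt_eT) => //=.
have mem_big e' : e' \in constraints_at (size e).-1 v ->
    h \in violations U v (size e).-1 e' ->
    h \in \bigcup_(d <- constraints_at (size e).-1 v) violations U v (size e).-1 d.
  by move=> e'c he'; apply: (mem_bigcup_seq e'c he').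
move: ve; rewrite mem_cat => /orP[ve|ve].
  apply: (mem_big e); first exact: mem_constraints_at1.
  by rewrite inE hE rh prednK // eqxx Ue ve; apply/allP.
apply: (mem_big (flip e)); first exact: mem_constraints_at2.
rewrite inE hE repeated_flip rh size_map prednK // eqxx /points !unzip_flip ve.
rewrite uniq_catC Ue /=; apply/allP => t; rewrite mem_cat orbC -mem_cat.
exact: eU.
Qed.

(** Strong induction on [#|U|]. Each good colouring has 8k+1 extensions. For k > 0, constraints of
    size n+1 spoil on average at most 2(n+1)k^(n+1)/(4k)^n of them, hence at most 2k/2^n as n+1 <=
    2^n. In total at most 4k are lost, and 4k+1 remain. *)
Lemma card_good_coloringsU1 U v : v \notin U ->
  (4 * k).+1 * #|good_colorings U| <= #|good_colorings (v |: U)|.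
Proof.
move Em: #|U| => m; elim/ltn_ind: m U v Em => m IHm U v Em vU.
have IH U' v' : #|U'| < #|U| -> v' \notin U' ->
   (4 * k).+1 * #|good_colorings U'| <= #|good_colorings (v' |: U')|.
  by rewrite Em => lt_m v_U; exact: (IHm _ lt_m _ _ erefl v_U).
set N := #|good_colorings U|.
pose b n := \sum_(e <- constraints_at n v) #|violations U v n e|.
have le_b : \sum_(n < #|T|) b n <= 2 * (2 * k * N).
  apply: sum_halving => n.
  (* The factor 4k+1 is weakened to 4k so that its powers split into powers of 2 and of k. *)
  have : (4 * k) ^ n * b n <= 2 * n.+1 * k ^ n.+1 * N.
    apply: (@leq_trans (size (constraints_at n v) * N)); last first.
      by rewrite leq_mul2r size_constraints_at orbT.
    rewrite -sum1_size big_distrl big_distrr /=; apply: leq_sum => e _.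
    rewrite mul1n; apply: leq_trans (card_violations n e vU IH).
    by rewrite leq_mul2r; apply/orP; right; case: (n) => [|n1] //; rewrite leq_exp2r.
  (* For k = 0 the power of k cannot be cancelled, but then [constraints_at n v] is empty. *)
  case: (posnP k) => [k0 _|k_gt0].
    suff -> : b n = 0 by rewrite muln0.
    have := size_constraints_at n v; rewrite [k ^ _](_ : _ = 0) ?k0 ?exp0n //.
    by rewrite muln0 leqn0 size_eq0 /b => /eqP ->; rewrite big_nil.
  have le_n : n.+1 <= 2 ^ n by exact: ltn_expl.
  move=> le1; rewrite -(leq_pmul2l (_ : 0 < 2 ^ n * k ^ n)); last first.
    by rewrite muln_gt0 !expn_gt0 k_gt0.
  apply: leq_trans (leq_trans le1 _).
    by rewrite -[4]/(2 * 2) !expnMn; lia.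
  rewrite expnS; set K := k ^ n; set P := 2 ^ n.
  rewrite (_ : 2 * n.+1 * (k * K) * N = n.+1 * (2 * k * K * N)); last by lia.
  rewrite (_ : P * K * (2 * k * N) = P * (2 * k * K * N)); last by lia.
  by rewrite leq_mul2r le_n orbT.
have := subset_leq_card (one_vertex_extensions_sub vU).
rewrite card_one_vertex_extensions // -/N => le_ext.
have {le_ext}: (8 * k).+1 * N <= #|good_colorings (v |: U)| + \sum_(n < #|T|) b n.
  apply: (leq_trans le_ext); apply: (leq_trans (leq_card_setU _ _)).
  rewrite leq_add2l; apply: (leq_trans (card_bigcup_seq _ _)).
  by apply: leq_sum => n _; exact: card_bigcup_seq.
by lia.
Qed.

(** Vertices are added one by one from the empty set, where the constant colouring is good because
    no constraint is empty; the count stays positive. *)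
Lemma nonrepetitive_coloring :
  exists f : T -> color, forall e, constraint e -> ~~ repeated f e.
Proof.
suff : 0 < #|good_colorings [set: T]%SET|.
  move=> /card_gt0P[f] /good_coloringsP[_ gf]; exists f => e Ce.
  by apply: gf => // t _; rewrite inE.
suff gt0 (s : seq T) : 0 < #|good_colorings [set t in s]|.
  by have := gt0 (enum T); rewrite (_ : [set t in _] = [set: T]%SET) //;
     apply/finset.setP => t; rewrite !inE mem_enum.
elim: s => [|v s IHs].
  apply/card_gt0P; exists [ffun=> ord0]; apply/good_coloringsP.
  split=> [t|[|[a b] e] Ce]; first by rewrite ffunE.
    by have := constraint_neq0 Ce.
  by move=> /(_ a); rewrite !inE eqxx => /(_ isT).
rewrite set_cons; case: (boolP (v \in [set t in s])) => [vs|/card_good_coloringsU1].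
  by rewrite (finset.setUidPr _) ?finset.sub1set.
by apply: leq_trans; rewrite muln_gt0.
Qed.

End Rosenfeld.

(** * Colouring the group *)

Section Topology.
Local Open Scope group_scope.
Local Open Scope classical_set_scope.
Variables (G : groupType) (A : finType).
Implicit Type x : full_shift G A.

Lemma nbhs_agree x (s : seq G) :
  nbhs x [set y : full_shift G A | {in s, forall h, y h = x h}].
Proof.
elim: s => [|h s IHs]; first by apply: filterS filterT.
have nbh : nbhs x [set y : full_shift G A | y h = x h].
  exact: (@proj_continuous _ (fun=> discrete_topology A) h x _ (discrete_set1 _)).
apply: filterS (filterI nbh IHs) => y [/= yh ys] t; rewrite inE.
by case/predU1P => [->|/ys].
Qed.

Lemma avoiding_subshift (F : set (pattern G A)) : is_subshift (avoiding F).
Proof.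
split=> [x clx p Fp [g gx]|g _ [x Fx <-] p Fp [k kx]].
  have [y [Fy yx]] := clx _ (nbhs_agree x [seq g * h | h <- domf p]).
  by apply: (Fy p Fp); exists g => h; rewrite yx ?map_f //; exact: valP.
by apply: (Fx p Fp); exists (g^-1 * k) => h; rewrite -kx /shift_action mulgA.
Qed.

Lemma full_shift_compact : compact [set: full_shift G A].
Proof.
have fin_compact (h : G) : compact [set: discrete_topology A].
  by apply: finite_compact; exact: (@finite_finset A setT).
have := tychonoff fin_compact.
by rewrite (_ : [set f | _] = setT) //; apply/seteqP; split.
Qed.

(** A requirement on finitely many cells defines a closed set, so a cluster point of the filter
    generated by all requirements satisfies each of them. *)
Lemma exists_satisfying (I : choiceType) (req : I -> full_shift G A -> Prop)
    (cells : I -> seq G) :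
    (forall i x y, {in cells i, forall h, x h = y h} -> req i x -> req i y) ->
    (forall J : seq I, exists x, forall i, i \in J -> req i x) ->
  exists x, forall i, req i x.
Proof.
move=> req_cells fin_req.
have finI_req : finI setT (fun i => [set x | req i x]).
  by move=> J _; have [x reqx] := fin_req (enum_fset J); exists x.
have FF := finI_filter finI_req.
have [x [_ clx]] := full_shift_compact FF (@filterT _ _ FF).
exists x => i.
pose F j := [set x | req j x].
have Fi : filter_from (finI_from setT F) id (F i).
  by exists (F i) => //; exact: (finI_from1 F).
have [y [reqy yx]] := clx _ _ Fi (nbhs_agree x (cells i)).
exact: req_cells reqy.
Qed.

End Topology.

(** * Repetitions along words of the group *)

Section Squares.
Local Open Scope group_scope.
Variables (G : groupType) (S : {fset G}).
Implicit Types (k : G) (w : word S).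

(** The first components, then the second ones, are the successive points of the path reading
    [w ++ w] from k. *)
Definition square k w : seq (G * G) :=
  [seq (k * word_value (take i w), k * word_value w * word_value (take i w))
     | i <- iota 0 (size w)].

Lemma word_value_cat w1 w2 :
  word_value (w1 ++ w2) = word_value w1 * word_value w2.
Proof. by rewrite /word_value big_cat. Qed.

Definition window (V : {fset G}) (ab : G * G) : option (V * V) :=
  if (insub ab.1, insub ab.2) is (Some a, Some b) then Some (a, b) else None.

Definition val_pair (V : {fset G}) (ab : V * V) : G * G := (val ab.1, val ab.2).

Lemma window_val V : pcancel (@val_pair V) (@window V).
Proof. by move=> [a b]; rewrite /window /= !valK. Qed.

Lemma window_map V e : pmap (window V) (map (@val_pair V) e) = e.
Proof. exact: (map_pK (@window_val V)). Qed.

(** The word w and the position i of v on the path of [w ++ w] determine the start k; positions in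
    the second half give flipped squares. A square leaving V loses pairs in [pmap], which does no
    harm: the list only has to contain the constraints and be short. *)
Definition squares_at (V : {fset G}) (n : nat) (v : V) : seq (seq (V * V)) :=
  [seq let k := val v * (word_value (take i (w ++ w)))^-1 in
       pmap (window V)
         (if i < n.+1 then square k w else flip (square k w))
     | w : n.+1.-tuple (letter S) <- enum {: n.+1.-tuple (letter S)},
       i <- iota 0 (2 * n.+1)].

Lemma size_squares_at V n v :
  size (@squares_at V n v) <= 2 * n.+1 * #|letter S| ^ n.+1.
Proof. by rewrite size_allpairs size_iota -cardE card_tuple mulnC. Qed.

Definition simple_square_in (V : {fset G}) (e : seq (V * V)) : Prop :=
  exists k w, [/\ 0 < size w, uniq (points (square k w))
                & map (@val_pair V) e = square k w].

Lemma finite_coloring (V : {fset G}) :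
  exists f : V -> 'I_(8 * #|letter S|).+1,
    forall e, simple_square_in e -> ~~ repeated f e.
Proof.
apply: (@nonrepetitive_coloring _ _ _ (@squares_at V)).
- move=> e [k [w [w0 _ ew]]].
  by rewrite -(size_map (@val_pair V)) ew size_map size_iota.
- move=> e [k [w [_ + ew]]]; rewrite -ew => Ue.
  apply: (@map_uniq _ _ val); apply: etrans Ue.
  by rewrite /points map_cat /unzip1 /unzip2 -!map_comp.
- move=> e v [k [w [w0 _ ew]]] /mapP[ab abe v1].
  have size_e : (size e).-1.+1 = size w.
    by rewrite -(size_map (@val_pair V)) ew size_map size_iota prednK.
  have : val_pair ab \in square k w by rewrite -ew map_f.
  case/mapP => i; rewrite mem_iota /= add0n => lt_iw [abk _].
  pose t := tcast (esym size_e) (in_tuple w).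
  have tw : t = w :> seq _ by rewrite val_tcast.
  rewrite -[X in X \in _](window_map e) ew; apply/allpairsP; exists (t, i); split.
  + by rewrite mem_enum.
  + by rewrite mem_iota leq0n /= add0n size_e (leq_trans lt_iw) ?leq_pmull.
  + by rewrite /= tw size_e lt_iw v1 abk takel_cat ?mulgK // ltnW.
- move=> e v [k [w [w0 _ ew]]] /mapP[ab abe v2].
  have size_e : (size e).-1.+1 = size w.
    by rewrite -(size_map (@val_pair V)) ew size_map size_iota prednK.
  have : val_pair ab \in square k w by rewrite -ew map_f.
  case/mapP => i; rewrite mem_iota /= add0n => lt_iw [_ abk].
  pose t := tcast (esym size_e) (in_tuple w).
  have tw : t = w :> seq _ by rewrite val_tcast.
  have -> : flip e = pmap (window V) (flip (square k w)).
    by rewrite -ew -(window_map (flip e)) /flip -!map_comp.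
  apply/allpairsP; exists (t, (size w + i)%N); split.
  (* Being the i-th second component, v has position [size w + i] on the path of [w ++ w]. *)
  + by rewrite mem_enum.
  + by rewrite mem_iota leq0n /= add0n size_e mul2n -addnn ltn_add2l.
  + rewrite /= tw size_e ltnNge leq_addr /= v2 abk take_cat ltnNge leq_addr /=.
    by rewrite addKn word_value_cat -[k * _ * _]mulgA mulgK.
- exact: size_squares_at.
Qed.

Lemma val_pair_window V (e : seq (G * G)) :
  {subset points e <= V} -> map (@val_pair V) (pmap (window V) e) = e.
Proof.
elim: e => //= -[a b] e IHe eV.
have aV : a \in V by apply: eV; rewrite mem_cat mem_head.
have bV : b \in V by apply: eV; rewrite mem_cat mem_head orbT.
rewrite [window V (a, b)]/window !insubT /= IHe // => g; rewrite mem_cat => ge.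
by apply: eV; rewrite mem_cat !inE; case/orP: ge => ->; rewrite ?orbT.
Qed.

Lemma simple_square_coloring :
  exists x : full_shift G 'I_(8 * #|letter S|).+1, forall k w,
    0 < size w -> uniq (points (square k w)) -> ~~ repeated x (square k w).
Proof.
pose req (kw : G * word S) (x : full_shift G 'I_(8 * #|letter S|).+1) :=
  0 < size kw.2 -> uniq (points (square kw.1 kw.2)) ->
  ~~ repeated x (square kw.1 kw.2).
pose cells (kw : G * word S) := points (square kw.1 kw.2).
have [||x reqx] := @exists_satisfying _ _ _ req cells.
- move=> [k w] x y xy reqx w0 Uw.
  rewrite -(@repeated_subset _ _ (mem (points (square k w))) x) //.
  exact: reqx.
- move=> J; pose V := [fset g in flatten [seq points (square kw.1 kw.2) | kw <- J]]%fset.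
  have [f fP] := finite_coloring V.
  (* The default [ord0] is never seen by the squares of J, whose points all lie in V. *)
  exists (fun g => if insub g is Some v then f v else ord0) => -[k w] kwJ w0 Uw.
  have eV : {subset points (square k w) <= V}.
    by move=> g gkw; rewrite inE; apply/flatten_mapP; exists (k, w).
  have e_eq := val_pair_window eV.
  rewrite -e_eq /repeated all_map; have := fP (pmap (window V) (square k w)).
  rewrite /repeated (@eq_all _ _ (fun ab => f ab.1 == f ab.2)) => [|[a b] /=].
    by apply; exists k, w.
  by rewrite !valK.
by exists x => k w; exact: (reqx (k, w)).
Qed.

Section Reduction.
Variables (B : eqType) (x : G -> B).
Let p w i := word_value (take i w).

Lemma repeated_squareP k w :
  reflect (forall i, i < size w -> x (k * p w i) = x (k * word_value w * p w i))
          (repeated x (square k w)).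
Proof.
rewrite /repeated all_map; apply: (iffP allP) => [xw i iw|xw i].
  by apply/eqP/xw; rewrite mem_iota.
by rewrite mem_iota => iw; apply/eqP/xw.
Qed.

Lemma prefix_value_add w i j :
  p w (i + j) = p w i * word_value (take j (drop i w)).
Proof. by rewrite /p takeD word_value_cat. Qed.

Hypothesis simple_nonrepeated : forall k w,
  0 < size w -> uniq (points (square k w)) -> ~~ repeated x (square k w).

(* A coincidence among the points of a square yields a shorter square whose
   pairs are among those of the given one. *)
Lemma square_nonrepeated k w :
  word_value w != 1 -> ~~ repeated x (square k w).
Proof.
have [n] := ubnP (size w); elim: n => // n IHn in k w *.
rewrite ltnS => le_wn w1; apply/negP => /[dup] rw /repeated_squareP xw.
have IH k' w' : size w' < size w -> word_value w' != 1 ->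
    (forall i, i < size w' ->
       x (k' * p w' i) = x (k' * word_value w' * p w' i)) -> False.
  move=> lt_w' w'1 xw'; have /negP := IHn k' w' (leq_trans lt_w' le_wn) w'1.
  by apply; exact/repeated_squareP.
have w0 : 0 < size w by case: (w) w1 => //; rewrite /word_value big_nil eqxx.
have p_neq i j : i < j -> j < size w -> p w i <> p w j.
  (* Cutting out the loop between positions i and j preserves the value of w, and every prefix of
     [w'] has the value of a prefix of w. *)
  move=> ij jw pij; pose w' := take i w ++ drop j w.
  have iw : i < size w by exact: ltn_trans jw.
  have vw' : word_value w' = word_value w.
    by rewrite word_value_cat -/(p w i) pij -word_value_cat cat_take_drop.
  have sw' : size w' = (i + (size w - j))%N.
    by rewrite size_cat size_drop size_takel // ltnW.
  apply: (IH k w'); rewrite ?vw' ?sw' //; first by lia.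
  move=> q lt_q; have [le_qi|lt_iq] := leqP q i.
    have -> : p w' q = p w q.
      by rewrite /p takel_cat ?take_takel // size_takel // ltnW.
    by apply: xw; exact: leq_ltn_trans iw.
  have -> : p w' q = p w (j + (q - i)).
    rewrite prefix_value_add -pij -word_value_cat /p take_cat.
    by rewrite size_takel ?(ltnW iw) // ltnNge ltnW.
  by apply: xw; lia.
have factor i j : i < j -> j < size w -> exists2 f : word S, size f < size w &
    word_value f = (p w i)^-1 * p w j /\
    forall q, q < size f -> p w i * p f q = p w (i + q) /\ i + q < size w.
  move=> ij jw; exists (take (j - i) (drop i w)).
    by rewrite size_take size_drop; case: ifP; lia.
  split; first by rewrite -[in RHS](subnKC (ltnW ij)) prefix_value_add mulKg.
  move=> q; rewrite size_take size_drop => lt_q; split.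
    by rewrite prefix_value_add {2}/p take_takel //; move: lt_q; case: ifP; lia.
  by move: lt_q; case: ifP; lia.
have p_neq_sym i j : i < size w -> j < size w -> p w i = p w j -> i = j.
  move=> iw jw pij; case: (ltngtP i j) => // [ij|ji].
    by case: (p_neq i j).
  by case: (p_neq j i).
suff Uw : uniq (points (square k w)) by have /negP := simple_nonrepeated w0 Uw.
rewrite cat_uniq /unzip1 /unzip2 -!map_comp !map_inj_in_uniq ?iota_uniq /=; last first.
- by move=> i j; rewrite !mem_iota => iw jw /= /mulgI; exact: p_neq_sym.
- by move=> i j; rewrite !mem_iota => iw jw /= /mulgI; exact: p_neq_sym.
rewrite andbT; apply/hasPn => _ /mapP[i + ->]; rewrite mem_iota /= add0n => iw.
apply/negP => /mapP[j]; rewrite mem_iota /= add0n -mulgA => jw /mulgI.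
rewrite -/(p w i) -/(p w j) => pij.
(* Here [p w j] is w times [p w i]. For i < j, the square of the factor f at [k * p w i] consists of
   pairs of the square of w; for j < i, the one at [k * word_value w * p w j] consists of such pairs
   swapped. In both cases f has value 1 only if w has; for i = j, w has value 1 at once. *)
case: (ltngtP i j) => [ij|ji|eq_ij].
- have [f lt_f [vf fq]] := factor i j ij jw.
  apply: (IH (k * p w i) f lt_f) => [|q /fq[pq iq]].
    apply: contra_neq w1; rewrite vf -pij => /(congr1 (fun z => p w i * z)).
    by rewrite mulVKg mulg1 -[RHS]mul1g => /mulIg.
  rewrite -!mulgA pq vf -!mulgA mulVKg -pij -!mulgA pq !mulgA.
  exact: xw.
- have [f lt_f [vf fq]] := factor j i ji iw.
  apply: (IH (k * word_value w * p w j) f lt_f) => [|q /fq[pq iq]].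
    apply: contra_neq w1; rewrite vf => /(congr1 (fun z => p w j * z)).
    by rewrite mulVKg mulg1 -pij -[LHS]mul1g => /mulIg.
  rewrite -!mulgA pq vf -!mulgA mulVKg [word_value w * (_ * _)]mulgA pij pq !mulgA.
  by apply/esym/xw.
- by move: pij w1; rewrite eq_ij -[RHS]mul1g => /mulIg ->; rewrite eqxx.
Qed.

End Reduction.

End Squares.

(** * The oracle machine *)

Section Machine.
Variables (L A : finType) (inv : L -> L).

(* [CompareP] and [CompareQ] check that the next two words extend the previous
   two by one and the same letter. *)
Inductive control : Type :=
  | Copy | Rewind | FirstColor | FirstWord of A | Query | Yes | No
  | CompareP | ColorP of L | CompareQ of L & A | ColorQ of A | Accept | Fail.

Definition control_code (q : control) : 'I_13 * option L * option A :=
  match q with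
  | Copy => (@Ordinal 13 0 isT, None, None)
  | Rewind => (@Ordinal 13 1 isT, None, None)
  | FirstColor => (@Ordinal 13 2 isT, None, None)
  | FirstWord a => (@Ordinal 13 3 isT, None, Some a)
  | Query => (@Ordinal 13 4 isT, None, None)
  | Yes => (@Ordinal 13 5 isT, None, None)
  | No => (@Ordinal 13 6 isT, None, None)
  | CompareP => (@Ordinal 13 7 isT, None, None)
  | ColorP s => (@Ordinal 13 8 isT, Some s, None)
  | CompareQ s a => (@Ordinal 13 9 isT, Some s, Some a)
  | ColorQ a => (@Ordinal 13 10 isT, None, Some a)
  | Accept => (@Ordinal 13 11 isT, None, None)
  | Fail => (@Ordinal 13 12 isT, None, None)
  end.

Definition control_decode (c : 'I_13 * option L * option A) : option control :=
  match nat_of_ord c.1.1, c.1.2, c.2 with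
  | 0, _, _ => Some Copy
  | 1, _, _ => Some Rewind
  | 2, _, _ => Some FirstColor
  | 3, _, Some a => Some (FirstWord a)
  | 4, _, _ => Some Query
  | 5, _, _ => Some Yes
  | 6, _, _ => Some No
  | 7, _, _ => Some CompareP
  | 8, Some s, _ => Some (ColorP s)
  | 9, Some s, Some a => Some (CompareQ s a)
  | 10, _, Some a => Some (ColorQ a)
  | 11, _, _ => Some Accept
  | _, _, _ => Some Fail
  end.

Lemma control_codeK : pcancel control_code control_decode.
Proof. by case. Qed.

HB.instance Definition _ := Finite.copy control (pcan_type control_codeK).

Definition sym : Type := option ((L + A) + void).

(* The new state, the moves of the heads on the input and on its copy (stay or
   right), and the action of the oracle head, after the copying phase.  The
   inverse of each letter is written leftwards, so that the oracle tape holds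
   the inverse of the word read.  The copy head waits on the blank cell before
   the copy until the first answer, and otherwise lags one pair of words behind
   the input head: a blank under it marks the first query. *)
Definition scan (q : control) (s0 s1 s2 : sym) :
    control * (bool * bool) * (sym * direction) :=
  let fail := (Fail, (false, false), (s2, Stay)) in
  let write s := (Some (inl (inl (inv s))), ToLeft) : sym * direction in
  match q, s0 with
  | FirstColor, Some (inl (inr a)) => (FirstWord a, (true, false), (s2, Stay))
  | FirstWord a, Some (inl (inl s)) => (FirstWord a, (true, false), write s)
  | FirstWord a, Some (inl (inr b)) =>
      if a == b then (Query, (true, false), (s2, ToRight)) else fail
  | Yes, _ => if s1 is None then fail else (Accept, (false, false), (s2, Stay))
  | No, _ => (CompareP, (false, ~~ isSome s1), (None, ToLeft))
  | CompareP, Some (inl (inl s)) =>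
      match s1 with
      | Some (inl (inl t)) =>
          if s == t then (CompareP, (true, true), (s2, Stay)) else fail
      | Some (inl (inr _)) => (ColorP s, (true, false), (s2, Stay))
      | _ => fail
      end
  | ColorP s, Some (inl (inr a)) => (CompareQ s a, (true, true), (s2, Stay))
  | CompareQ s a, Some (inl (inl t)) =>
      match s1 with
      | Some (inl (inl t')) =>
          if t == t' then (CompareQ s a, (true, true), write t) else fail
      | Some (inl (inr _)) =>
          if t == s then (ColorQ a, (true, false), write t) else fail
      | _ => fail
      end
  | ColorQ a, Some (inl (inr b)) =>
      if a == b then (Query, (true, true), (s2, ToRight)) else fail
  | Accept, _ => (Accept, (false, false), (s2, Stay))
  | _, _ => fail
  end.

Definition go (b : bool) : direction := if b then ToRight else Stay.

(** The input is copied to the second tape and both heads are rewound to the blank before the word;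
    then only the input head steps onto the word, and [scan] takes over. *)
Definition rules (q : control) (s0 s1 s2 : sym) :
    control * ((sym * direction) * (sym * direction) * (sym * direction)) :=
  match q, s0 with
  | Copy, Some _ => (Copy, ((s0, ToRight), (s0, ToRight), (s2, Stay)))
  | Copy, None => (Rewind, ((s0, ToLeft), (s1, ToLeft), (s2, Stay)))
  | Rewind, Some _ => (Rewind, ((s0, ToLeft), (s1, ToLeft), (s2, Stay)))
  | Rewind, None => (FirstColor, ((s0, ToRight), (s1, Stay), (s2, Stay)))
  | _, _ => let: (q', (m0, m1), act) := scan q s0 s1 s2 in
            (q', ((s0, go m0), (s1, go m1), act))
  end.

Definition triple (X : Type) (x0 x1 x2 : X) : {ffun 'I_3 -> X} :=
  [ffun i : 'I_3 => if i == ord0 then x0 else if i == ord_max then x2 else x1].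

Definition copy_index : 'I_3 := Ordinal (isT : 1 < 3).

Definition square_checker : oracle_machine (L + A)%type :=
  @OracleMachine (L + A)%type control void 2 Copy Accept Query Yes No
    (fun q s =>
       let: (q', (a0, a1, a2)) := rules q (s ord0) (s copy_index) (s ord_max) in
       (q', triple a0 a1 a2)).

Local Notation M := square_checker.
Local Notation tape := (tape M).

(** * Copying, rewinding and the abstract machine *)

Variable O : set (seq (L + A)).

Lemma tripleE (X : Type) (x0 x1 x2 : X) :
  (triple x0 x1 x2 ord0 = x0) * (triple x0 x1 x2 copy_index = x1) *
  (triple x0 x1 x2 ord_max = x2).
Proof.
by rewrite !ffunE.
Qed.

Definition conf (q : control) (t0 t1 t2 : tape) : configuration M :=
  (q, triple t0 t1 t2).

Lemma step_conf q t0 t1 t2 : q != Query ->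
  step O (conf q t0 t1 t2) =
  let: (q', (a0, a1, a2)) := rules q (scanned t0) (scanned t1) (scanned t2) in
  conf q' (write_and_move t0 a0) (write_and_move t1 a1) (write_and_move t2 a2).
Proof.
move=> qQ; case Er: (rules q _ _ _) => [q' [[a0 a1] a2]].
by rewrite /step /= (negPf qQ) !ffunE /= Er; congr pair;
   apply/ffunP => i; rewrite !ffunE; do 2?case: ifP.
Qed.

Lemma step_query t0 t1 t2 :
  step O (conf Query t0 t1 t2) =
  conf (if `[< O (queried_word t2) >] then Yes else No) t0 t1 t2.
Proof. by rewrite /step /= tripleE. Qed.

Definition embed (z : seq (L + A)) : seq sym := [seq Some (inl a) | a <- z].

Definition at_word (l z : seq sym) : tape := @Tape _ M l (head None z) (behead z).

Lemma initialE u :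
  initial M u =
  conf Copy (at_word [::] (embed u)) (at_word [::] [::]) (at_word [::] [::]).
Proof. by congr pair; apply/ffunP => i; rewrite !ffunE; do 2?case: ifP. Qed.

Lemma copy_run l z t2 :
  iter (size z) (step O) (conf Copy (at_word l (embed z)) (at_word l [::]) t2) =
  conf Copy (at_word (rev (embed z) ++ l) [::])
    (at_word (rev (embed z) ++ l) [::]) t2.
Proof.
case: t2 => ? ? ?; elim: z l => [|a z IHz] l //; rewrite iterSr step_conf //=.
by rewrite -[embed z]/(embed z) rev_cons cat_rcons -IHz.
Qed.

Lemma rewind_run z r t2
    (t := @Tape _ M (behead (embed z)) (head None (embed z)) r) :
  iter (size z) (step O) (conf Rewind t t t2) =
  conf Rewind (at_word [::] (None :: rev (embed z) ++ r))
    (at_word [::] (None :: rev (embed z) ++ r)) t2.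
Proof.
case: t2 => ? ? ?; rewrite {}/t; elim: z r => [|a z IHz] r //.
rewrite iterSr step_conf //=.
by rewrite rev_cons cat_rcons -IHz.
Qed.

(** [size u] steps copy, one turns back, [size u] rewind, and one leaves the blank. *)
Lemma startup_run u :
  iter (1 + (size u + (1 + size u))) (step O) (initial M u) =
  conf FirstColor (at_word [:: None] (rcons (embed u) None))
    (at_word [::] (None :: rcons (embed u) None)) (at_word [::] [::]).
Proof.
rewrite !iterD initialE copy_run cats0 [iter 1 _ (conf _ _ _ _)]step_conf //=.
have := @rewind_run (rev u) [:: None] (at_word [::] [::]).
rewrite size_rev /embed map_rev revK cats1 => ->.
by rewrite step_conf.
Qed.

(* Only the part of the input and of its copy from the scanned cell on matters. *)
Definition abstract_conf : Type := control * seq sym * seq sym * tape.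

Definition advance (b : bool) (z : seq sym) := if b then behead z else z.

Definition abstract_step (c : abstract_conf) : abstract_conf :=
  let: (q, z0, z1, t2) := c in
  if q == Query then
    (if `[< O (queried_word t2) >] then Yes else No, z0, z1, t2)
  else
    let: (q', (m0, m1), act) :=
      scan q (head None z0) (head None z1) (scanned t2) in
    (q', advance m0 z0, advance m1 z1, write_and_move t2 act).

(** Outside [Copy] and [Rewind] the first two heads never move left, so the cells behind them can be
    quantified away. *)
Definition represents (c : abstract_conf) (k : configuration M) : Prop :=
  let: (q, z0, z1, t2) := c in
  [/\ q <> Copy, q <> Rewind &
      exists l0 l1, k = conf q (at_word l0 z0) (at_word l1 z1) t2].

Lemma scan_control q s0 s1 s2 :
  (scan q s0 s1 s2).1.1 <> Copy /\ (scan q s0 s1 s2).1.1 <> Rewind.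
Proof.
by case: q => [||| ?||||| ?|? ?|?||] //=; case: s0 => [[[?|?]|[]]|] //=;
  case: s1 => [[[?|?]|[]]|] //=; case: ifP.
Qed.

Lemma represents_step c k :
  represents c k -> represents (abstract_step c) (step O k).
Proof.
move: c => [[[q z0] z1] t2] [qC qR [l0 [l1 ->]]].
have [->|qQ] := eqVneq q Query.
  rewrite step_query /=; case: ifP => _; split=> //; by exists l0, l1.
have go_at b l z : exists l', write_and_move (at_word l z) (head None z, go b)
    = at_word l' (advance b z).
  by case: b; [exists (head None z :: l) | exists l].
rewrite step_conf // /abstract_step (negPf qQ).
rewrite (_ : rules _ _ _ _ = let: (q', (m0, m1), act) :=
    scan q (head None z0) (head None z1) (scanned t2) in
    (q', ((head None z0, go m0), (head None z1, go m1), act))); last first.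
  by case: (q) qC qR.
case Es: (scan _ _ _ _) => [[q' [m0 m1]] act].
have [l0' ->] := go_at m0 l0 z0; have [l1' ->] := go_at m1 l1 z1.
have := scan_control q (head None z0) (head None z1) (scanned t2).
by rewrite Es => -[]; split=> //; exists l0', l1'.
Qed.

Lemma accept_absorbing (k : configuration M) n :
  k.1 = Accept -> (iter n (step O) k).1 = Accept.
Proof. by move=> k1; elim: n => //= n; case: (iter _ _ _) => q ts /= ->. Qed.

Lemma represents_iter c k n :
  represents c k -> represents (iter n abstract_step c) (iter n (step O) k).
Proof. by move=> ck; elim: n => //= n; exact: represents_step. Qed.

Lemma represents_control c k : represents c k -> k.1 = c.1.1.1.
Proof. by case: c => [[[q z0] z1] t2] [_ _ [l0 [l1 ->]]]. Qed.

(** The listed blank is the cell on which the heads turned back after copying. *)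
Definition blank_end (z : seq (L + A)) : seq sym := rcons (embed z) None.

Definition abstract_start (u : seq (L + A)) : abstract_conf :=
  (FirstColor, blank_end u, None :: blank_end u, at_word [::] [::]).

Lemma accepts_abstract u :
  accepts M O u <->
  exists n, (iter n abstract_step (abstract_start u)).1.1.1 = Accept.
Proof.
set m := (1 + (size u + (1 + size u)))%N.
have start_u : represents (abstract_start u) (iter m (step O) (initial M u)).
  rewrite startup_run; split=> //; exists [:: None], [::]; congr conf.
have run n : (iter n abstract_step (abstract_start u)).1.1.1 =
    (iter (m + n) (step O) (initial M u)).1.
  by rewrite addnC iterD (represents_control (represents_iter n start_u)).
split=> [[n acc_n]|[n acc_n]]; last by exists (m + n); rewrite -run.
by exists n; rewrite run iterD accept_absorbing.
Qed.

(** * The oracle tape *)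

Variable triv : seq L -> Prop.
(** [triv w] abstracts [word_value w = 1]; the query is the inverse of w, which is trivial exactly
    when w is. *)
Hypothesis oracle_triv :
  forall w, O [seq inl s | s <- rev (map inv w)] <-> triv w.

Definition oracle_word (w : seq L) (R : seq sym) : seq sym :=
  embed [seq inl s | s <- rev (map inv w)] ++ R.

Lemma oracle_word_rcons w s R :
  oracle_word (rcons w s) R = Some (inl (inl (inv s))) :: oracle_word w R.
Proof. by rewrite /oracle_word map_rcons rev_rcons. Qed.

(** R is the residue of earlier queries: it is empty or starts with a blank, so a query ends where R
    begins. *)
Definition writing (w : seq L) (t2 : tape) : Prop :=
  exists2 R : seq sym, @input_prefix _ M R = [::] &
    t2 = @Tape _ M [::] None (oracle_word w R).

Definition asking (w : seq L) (t2 : tape) : Prop :=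
  exists2 R : seq sym, @input_prefix _ M R = [::] &
    t2 = @Tape _ M [:: None] (head None (oracle_word w R))
           (behead (oracle_word w R)).

Lemma writing_letter w s t2 :
  writing w t2 ->
  writing (rcons w s) (write_and_move t2 (Some (inl (inl (inv s))), ToLeft)).
Proof. by move=> [R R0 ->]; exists R; rewrite ?oracle_word_rcons. Qed.

Lemma writing_stay w t2 :
  writing w t2 -> writing w (write_and_move t2 (scanned t2, Stay)).
Proof. by case: t2. Qed.

Lemma writing_ask w t2 :
  writing w t2 -> asking w (write_and_move t2 (scanned t2, ToRight)).
Proof. by move=> [R R0 ->]; exists R. Qed.

(** Blanking the first cell is enough: the rest of the old query then lies beyond a blank, out of
    reach of the next one. *)
Lemma asking_restart w t2 :
  asking w t2 -> writing [::] (write_and_move t2 (None, ToLeft)).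
Proof. by move=> [R R0 ->]; exists (None :: behead (oracle_word w R)). Qed.

Lemma asking_query w t2 : asking w t2 -> O (queried_word t2) <-> triv w.
Proof.
move=> [R R0 t2E]; rewrite -oracle_triv.
suff -> : queried_word t2 = [seq inl s | s <- rev (map inv w)] by [].
rewrite t2E /queried_word /= /oracle_word.
case: (rev (map inv w)) => [|s z] /=.
  by case: R R0 {t2E} => [|[[a|[]]|] R].
by congr cons; elim: z => [|a z /= ->].
Qed.

(** * The scanning invariant and soundness *)

Definition enc (c : seq (seq L * A)) : seq (L + A) :=
  flatten [seq rcons [seq inl s | s <- t.1] (inr t.2) | t <- c].

Fixpoint pairs_from (p q : seq L) (l : seq (L * A)) : seq (seq L * A) :=
  if l is (s, a) :: l' then
    (rcons p s, a) :: (rcons q s, a) :: pairs_from (rcons p s) (rcons q s) l'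
  else [::].

(* The words p_0 = [::], v p_0, p_1, v p_1, ..., where p_i is the prefix of
   length i of [unzip1 l]. *)
Definition pairs (v : seq L) (a : A) (l : seq (L * A)) : seq (seq L * A) :=
  ([::], a) :: (v, a) :: pairs_from [::] v l.

Definition last_color (a : A) (l : seq (L * A)) : A := last a (unzip2 l).

Definition last_pair (v : seq L) (a : A) (l : seq (L * A)) : seq (seq L * A) :=
  [:: (unzip1 l, last_color a l); (v ++ unzip1 l, last_color a l)].

Lemma pairs_from_rcons p q l s a :
  pairs_from p q (rcons l (s, a)) =
  pairs_from p q l ++
  [:: (rcons (p ++ unzip1 l) s, a); (rcons (q ++ unzip1 l) s, a)].
Proof.
elim: l p q => [|[t b] l IHl] p q /=; first by rewrite !cats0.
by rewrite IHl !cat_rcons.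
Qed.

Lemma pairs_rcons v a l s b :
  pairs v a (rcons l (s, b)) = pairs v a l ++ last_pair v a (rcons l (s, b)).
Proof.
rewrite /pairs pairs_from_rcons /last_pair /last_color /unzip1 /unzip2.
by rewrite !map_rcons last_rcons -rcons_cat.
Qed.

Definition answered (q : control) (w : seq L) : Prop :=
  [\/ q = Query, q = Yes /\ triv w | q = No /\ ~ triv w].

(** The invariant of the scan: z is the unread input, and the equation for u records what has been
    checked of the part read. During comparisons [w'] is the part of the earlier word still to be
    matched, and the copy tape goes on with everything up to the end of the input. *)
Inductive reachable (u : seq (L + A)) : abstract_conf -> Prop :=
| ReachFirstColor t2 : writing [::] t2 ->
    reachable u (FirstColor, blank_end u, None :: blank_end u, t2)
| ReachFirstWord a w z t2 : u = inr a :: map inl w ++ z -> writing w t2 ->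
    reachable u (FirstWord a, blank_end z, None :: blank_end u, t2)
| ReachFirstQuery q v a z t2 :
    u = enc (pairs v a [::]) ++ z -> asking v t2 -> answered q v ->
    reachable u (q, blank_end z, None :: blank_end u, t2)
| ReachQuery q v a l z t2 :
    u = enc (pairs v a l) ++ z -> asking (v ++ unzip1 l) t2 -> ~ triv v ->
    answered q (v ++ unzip1 l) ->
    reachable u (q, blank_end z, blank_end (enc (last_pair v a l) ++ z), t2)
| ReachCompareP v a l w w' z t2 :
    u = enc (pairs v a l) ++ map inl w ++ z -> writing [::] t2 -> ~ triv v ->
    unzip1 l = w ++ w' ->
    reachable u (CompareP, blank_end z,
      blank_end (map inl w' ++ inr (last_color a l) ::
        map inl (v ++ unzip1 l) ++ inr (last_color a l) :: map inl w ++ z), t2)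
| ReachColorP v a l s z t2 :
    u = enc (pairs v a l) ++ map inl (rcons (unzip1 l) s) ++ z ->
    writing [::] t2 -> ~ triv v ->
    reachable u (ColorP s, blank_end z,
      blank_end (inr (last_color a l) :: map inl (v ++ unzip1 l) ++
        inr (last_color a l) :: map inl (rcons (unzip1 l) s) ++ z), t2)
| ReachCompareQ v a l s b w w' z t2 :
    u = enc (pairs v a l) ++ map inl (rcons (unzip1 l) s) ++ inr b ::
          map inl w ++ z ->
    writing w t2 -> ~ triv v -> v ++ unzip1 l = w ++ w' ->
    reachable u (CompareQ s b, blank_end z,
      blank_end (map inl w' ++ inr (last_color a l) ::
        map inl (rcons (unzip1 l) s) ++ inr b :: map inl w ++ z), t2)
| ReachColorQ v a l s b z t2 :
    u = enc (pairs v a l) ++ map inl (rcons (unzip1 l) s) ++ inr b ::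
          map inl (rcons (v ++ unzip1 l) s) ++ z ->
    writing (rcons (v ++ unzip1 l) s) t2 -> ~ triv v ->
    reachable u (ColorQ b, blank_end z,
      blank_end (inr (last_color a l) :: map inl (rcons (unzip1 l) s) ++
        inr b :: map inl (rcons (v ++ unzip1 l) s) ++ z), t2)
| ReachAccept v a l z z0 z1 t2 :
    u = enc (pairs v a l) ++ z -> ~ triv v -> triv (v ++ unzip1 l) ->
    reachable u (Accept, z0, z1, t2)
| ReachFail z0 z1 t2 : reachable u (Fail, z0, z1, t2).

Lemma enc_cat c d : enc (c ++ d) = enc c ++ enc d.
Proof. by rewrite /enc map_cat flatten_cat. Qed.

Lemma enc_cons2 p q a b c z :
  enc ((p, a) :: (q, b) :: c) ++ z =
  map inl p ++ inr a :: map inl q ++ inr b :: enc c ++ z.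
Proof. by rewrite /enc /= -!cats1 -!catA. Qed.

Lemma enc_last_pair v a l z (b := last_color a l) :
  enc (last_pair v a l) ++ z =
  map inl (unzip1 l) ++ inr b :: map inl (v ++ unzip1 l) ++ inr b :: z.
Proof. exact: enc_cons2. Qed.

Lemma map_inl_rcons (w : seq L) s (z : seq (L + A)) :
  map inl (rcons w s) ++ z = map inl w ++ inl s :: z.
Proof. by rewrite map_rcons cat_rcons. Qed.

Lemma answer w t2 : asking w t2 ->
  answered (if `[< O (queried_word t2) >] then Yes else No) w.
Proof.
move=> /asking_query Ow; case: asboolP => [/Ow tw|nO]; first by apply: Or32.
by apply: Or33; split=> // /Ow.
Qed.

Lemma reachable_step u c : reachable u c -> reachable u (abstract_step c).
Proof.
case=> {c}.
- move=> t2 wr; case: u => [|[s|a] u]; try exact: ReachFail.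
  exact: (@ReachFirstWord _ a [::] u _ erefl (writing_stay wr)).
- move=> a w [|[s|b] z] t2 def_u wr; try exact: ReachFail.
    apply: (@ReachFirstWord _ a (rcons w s)); last exact: writing_letter.
    by rewrite map_inl_rcons.
  rewrite /abstract_step /=; case: eqP => [ab|_]; last exact: ReachFail.
  apply: (@ReachFirstQuery _ Query w a); last by constructor.
    by rewrite def_u ab /enc /= cats0 cat_rcons.
  exact: writing_ask.
- move=> q v a z t2 def_u ask [->|[-> tv]|[-> ntv]].
  + rewrite /abstract_step eqxx.
    exact: ReachFirstQuery def_u ask (answer ask).
  + exact: ReachFail.
  + have := @ReachCompareP u v a [::] [::] [::] z _
      def_u (asking_restart ask) ntv erefl.
    by rewrite /abstract_step /= {3}def_u /enc /= !cats0 cat_rcons.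
- move=> q v a l z t2 def_u ask ntv [->|[-> tv]|[-> ntv']].
  + by rewrite /abstract_step eqxx; exact: ReachQuery def_u ask ntv (answer ask).
  (* The copy head has left the initial blank, so this positive answer is not the one to the first
     query and leads to [Accept]. *)
  + have hd : head None (blank_end (enc (last_pair v a l) ++ z)) <> None.
      by rewrite enc_last_pair; case: (unzip1 l).
    rewrite /abstract_step; case: (head None _) hd => //= x _.
    exact: ReachAccept def_u ntv tv.
  + have := @ReachCompareP u v a l [::] (unzip1 l) z _
      def_u (asking_restart ask) ntv erefl.
    rewrite /abstract_step /=.
    have -> : isSome (head None (blank_end (enc (last_pair v a l) ++ z))).
      by rewrite enc_last_pair; case: (unzip1 l).
    by rewrite enc_last_pair.
- move=> v a l w w' [|[s|b] z] t2 def_u wr ntv lw; try exact: ReachFail.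
  (* If [w'] is empty the copy head is on a colour, and s is the letter by which the new word
     extends the old one. *)
  rewrite /abstract_step /=; case: w' lw => [|t w'] lw /=.
    rewrite cats0 in lw; rewrite -lw -map_inl_rcons.
    apply: ReachColorP ntv; last exact: writing_stay.
    by rewrite lw map_inl_rcons.
  case: eqP => [st|_]; last exact: ReachFail.
  rewrite -map_inl_rcons; apply: ReachCompareP (writing_stay wr) ntv _.
    by rewrite map_inl_rcons.
  by rewrite lw st cat_rcons.
- move=> v a l s [|[t|b] z] t2 def_u wr ntv; try exact: ReachFail.
  rewrite /abstract_step /=.
  by apply: (@ReachCompareQ _ v a l s b [::]) (writing_stay wr) ntv _.
- move=> v a l s b w w' [|[t|c] z] t2 def_u wr ntv vw; try exact: ReachFail.
  rewrite /abstract_step /=; case: w' vw => [|t' w'] vw /=.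
    case: eqP => [ts|_]; last exact: ReachFail.
    rewrite cats0 in vw; rewrite ts -map_inl_rcons -vw.
    apply: ReachColorQ ntv; last by rewrite vw -ts; exact: writing_letter.
    by rewrite def_u vw ts !map_inl_rcons.
  case: eqP => [tt|_]; last exact: ReachFail.
  rewrite -map_inl_rcons; apply: ReachCompareQ (writing_letter _ wr) ntv _.
    by rewrite def_u !map_inl_rcons.
  by rewrite vw tt cat_rcons.
- move=> v a l s b [|[t|c] z] t2 def_u wr ntv; try exact: ReachFail.
  rewrite /abstract_step /=; case: eqP => [bc|_]; last exact: ReachFail.
  have lw : unzip1 (rcons l (s, b)) = rcons (unzip1 l) s.
    by rewrite /unzip1 map_rcons.
  have lb : last_color a (rcons l (s, b)) = b.
    by rewrite /last_color /unzip2 map_rcons last_rcons.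
  (* The new pair is complete: l grows by [(s, b)], and the copy head is at the start of this
     pair. *)
  have := @ReachQuery u Query v a (rcons l (s, b)) z _ _
    (writing_ask _) ntv (Or31 _ _ _).
  rewrite enc_last_pair lw lb -rcons_cat {3}bc; apply=> //.
  by rewrite pairs_rcons enc_cat -catA enc_last_pair lw lb -rcons_cat {2}bc.
- by move=> v a l z z0 z1 t2 def_u ntv tv; exact: ReachAccept def_u ntv tv.
- by move=> z0 z1 t2; exact: ReachFail.
Qed.

Lemma accepts_sound u : accepts M O u ->
  exists v a l z,
    [/\ u = enc (pairs v a l) ++ z, ~ triv v & triv (v ++ unzip1 l)].
Proof.
case/accepts_abstract => n.
have: reachable u (iter n abstract_step (abstract_start u)).
  elim: n => [|n IHn] /=; last exact: reachable_step.
  by apply: ReachFirstColor; exists [::].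
case=> //= [? ? ? ? ? _ _ [->|[-> _]|[-> _]] //||].
- by move=> ? ? ? ? ? ? _ _ _ [->|[-> _]|[-> _]].
- by move=> v a l z _ _ _ def_u ntv tv _; exists v, a, l, z.
Qed.

(** * Completeness of the machine *)

Definition accepting (c : abstract_conf) : Prop :=
  exists n, (iter n abstract_step c).1.1.1 = Accept.

Lemma accepting_step c : accepting (abstract_step c) -> accepting c.
Proof. by move=> [n acc_n]; exists n.+1; rewrite iterSr. Qed.

Lemma run_first_word a w v z z1 t2 : writing w t2 ->
    (forall t2', asking (w ++ v) t2' -> accepting (Query, blank_end z, z1, t2')) ->
  accepting (FirstWord a, blank_end (map inl v ++ inr a :: z), z1, t2).
Proof.
elim: v w t2 => [|s v IHv] w t2 wr acc; apply: accepting_step.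
  rewrite /abstract_step /= eqxx; apply: acc; rewrite cats0; exact: writing_ask.
apply: (IHv (rcons w s)); first exact: writing_letter.
by rewrite cat_rcons.
Qed.

Lemma run_compare_p p s b c z z' t2 : writing [::] t2 ->
    (forall t2', writing [::] t2' ->
       accepting (CompareQ s b, blank_end z, blank_end z', t2')) ->
  accepting (CompareP, blank_end (map inl (rcons p s) ++ inr b :: z),
    blank_end (map inl p ++ inr c :: z'), t2).
Proof.
move=> + acc; elim: p t2 => [|t p IHp] t2 wr; apply: accepting_step; last first.
  by rewrite /abstract_step /= eqxx; apply/IHp/writing_stay.
apply: accepting_step; apply: acc; exact/writing_stay/writing_stay.
Qed.

Lemma run_compare_q w q s b c z z' t2 : writing w t2 ->
    (forall t2', asking (w ++ rcons q s) t2' ->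
       accepting (Query, blank_end z, blank_end z', t2')) ->
  accepting (CompareQ s b, blank_end (map inl (rcons q s) ++ inr b :: z),
    blank_end (map inl q ++ inr c :: z'), t2).
Proof.
elim: q w t2 => [|t q IHq] w t2 wr acc; apply: accepting_step; last first.
  rewrite /abstract_step /= eqxx; apply: (IHq (rcons w t)).
    exact: writing_letter.
  by rewrite cat_rcons.
rewrite /abstract_step /= eqxx; apply: accepting_step.
rewrite /abstract_step /= eqxx; apply/acc/writing_ask.
by rewrite cats1; exact: writing_letter.
Qed.

(** Induction on l: the first pair of [pairs_from p q l] is compared with the pair before it, and
    then takes its place on the copy tape. *)
Lemma run_pairs p q a b l z t2 :
    l != [::] -> triv (q ++ unzip1 l) -> writing [::] t2 ->
  accepting (CompareP, blank_end (enc (pairs_from p q l) ++ z),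
    blank_end (enc [:: (p, a); (q, b)] ++ enc (pairs_from p q l) ++ z), t2).
Proof.
elim: l p q a b t2 => // -[s c] l IHl p q a b t2 _ trivl wr.
rewrite !enc_cons2 [enc [::] ++ _]/=.
apply: run_compare_p wr _ => t2' wr'.
apply: run_compare_q wr' _ => t3 ask; rewrite cat0s in ask.
apply: accepting_step; rewrite /abstract_step eqxx; case: asboolP.
  (* A query may be answered positively before l is exhausted; acceptance then comes early. *)
  move=> _; apply: accepting_step; exists 0.
  by rewrite /abstract_step /=; case: (p).
move=> /(contra_not (asking_query ask).2) ntriv; apply: accepting_step.
rewrite /abstract_step /=.
have -> : advance (~~ isSome (head None (blank_end (map inl (rcons p s) ++
    inr c :: map inl (rcons q s) ++ inr c ::
    enc (pairs_from (rcons p s) (rcons q s) l) ++ z)))) = id.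
  by case: (p).
have := IHl (rcons p s) (rcons q s) c c _ _ _ (asking_restart ask).
rewrite enc_cons2; apply.
(* After a negative answer l cannot be exhausted, since the last word is trivial. *)
- by apply: contra_notN ntriv => /eqP l0; move: trivl; rewrite l0 /= cats1.
- by rewrite cat_rcons.
Qed.

Lemma accepts_complete v a l z :
  ~ triv v -> triv (v ++ unzip1 l) -> accepts M O (enc (pairs v a l) ++ z).
Proof.
move=> ntv trivl; apply/accepts_abstract/accepting_step.
rewrite /pairs enc_cons2 /abstract_step /=.
apply: (@run_first_word a [::]) => [|t2 ask]; first by exists [::].
apply: accepting_step; rewrite /abstract_step eqxx; case: asboolP.
  by move/(asking_query ask).
move=> _; apply: accepting_step; rewrite /abstract_step /=.
have := @run_pairs [::] v a a l z _ _ trivl (asking_restart ask).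
rewrite enc_cons2; apply.
by apply: contra_notN ntv => /eqP l0; move: trivl; rewrite l0 /= cats0.
Qed.
End Machine.

(** * The subshift *)

Section Codings.
Local Open Scope group_scope.
Local Open Scope classical_set_scope.
Variables (G : groupType) (S : {fset G}) (A : finType).
Implicit Types (c d : pattern_coding S A) (x : full_shift G A).

Lemma codified_match c (P : pattern G A) x g t :
  consistent c -> codifies c P -> (forall h : domf P, x (g * val h) = P h) ->
  t \in c -> x (g * word_value t.1) = t.2.
Proof.
move=> cc [cP Pc] xP tc; have [t' t'c [t'v Pt']] := Pc [` cP t tc]%fset.
by rewrite -[word_value _]/(val [` cP t tc]%fset) xP Pt'; apply: cc.
Qed.

(** A coding matched by x at g is automatically consistent, and it codifies the pattern P read off x
    at g. *)
Lemma avoiding_mismatch (C : set (pattern_coding S A)) c x g :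
  avoiding (codified_patterns C) x -> C c ->
  ~ forall t, t \in c -> x (g * word_value t.1) = t.2.
Proof.
move=> xC Cc xc.
pose P : pattern G A :=
  [fmap h : [fset word_value t.1 | t in c]%fset => x (g * val h)]%fmap.
apply: (xC P); last by exists g => h; rewrite ffunE.
exists c; split=> // [t u tc uc tu|]; first by rewrite -!xc // tu.
split=> [t tc|h]; first by apply/imfsetP; exists t.
have /imfsetP[t /= tc ht] := valP h; exists t => //; split=> //.
by rewrite ffunE ht xc.
Qed.

(** The machine may accept before the end of its input. As each colour closes a tuple, the part it
    has read consists of whole tuples of c. *)
Lemma encode_prefix c d z : encode c = encode d ++ z -> exists c', c = d ++ c'.
Proof.
elim: d c => [|[w a] d IHd] [|[w' a'] c].
- by exists [::].
- by exists ((w', a') :: c).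
- by rewrite /encode /=; case: w.
rewrite /encode /= -!cats1 -!catA /= => cd.
suff [-> -> /IHd[c' ->]] : [/\ w' = w, a' = a & encode c = encode d ++ z].
  by exists c'.
elim: w w' cd => [|s w IHw] [|s' w'] //= [-> cd]; first by [].
by have [-> -> ->] := IHw w' cd.
Qed.

End Codings.

Section Letters.
Local Open Scope group_scope.
Variables (G : groupType) (S : {fset G}).

(** The default s of [insubd] is never taken, as the letters are closed under inversion. *)
Definition inverse_letter (s : letter S) : letter S := insubd s (val s)^-1.

Lemma val_inverse_letter s : val (inverse_letter s) = (val s)^-1.
Proof.
rewrite val_insubd; case: ifP => // /negP[]; have := valP s.
rewrite !inE => /orP[sS|/imfsetP[t /= tS ->]]; last by rewrite invgK tS.
by apply/orP; right; apply/imfsetP; exists (val s).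
Qed.

Lemma word_value_inverse (w : word S) :
  word_value (rev (map inverse_letter w)) = (word_value w)^-1.
Proof.
rewrite /word_value; elim: w => [|s w IHw] /=; first by rewrite !big_nil invg1.
rewrite rev_cons -cats1 big_cat /= IHw big_seq1 big_cons.
by rewrite invgM val_inverse_letter.
Qed.

Lemma wp_oracle_inverse (A : finType) (w : word S) :
  @wp_oracle G S A [seq inl s | s <- rev (map inverse_letter w)] <->
  word_value w = 1.
Proof.
split=> [[w' w'1 /inj_map eq_w]|w1].
  have {eq_w}eq_w : w' = rev (map inverse_letter w) by apply: eq_w => a b [].
  move: w'1; rewrite /word_problem /= eq_w word_value_inverse => /eqP.
  by rewrite invg_eq1 => /eqP.
exists (rev (map inverse_letter w)) => //.
by rewrite /word_problem /= word_value_inverse w1 invg1.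
Qed.

End Letters.

Lemma mem_pairs (L A : finType) (v : seq L) (a : A) (l : seq (L * A)) i :
  i < size l -> exists b, (take i (unzip1 l), b) \in pairs v a l /\
    (v ++ take i (unzip1 l), b) \in pairs v a l.
Proof.
case: i => [|i] il.
  by exists a; rewrite take0 cats0 !inE !eqxx orbT.
suff [b [pb qb]] : exists b,
    ([::] ++ take i.+1 (unzip1 l), b) \in pairs_from [::] v l /\
    (v ++ take i.+1 (unzip1 l), b) \in pairs_from [::] v l.
  by exists b; rewrite !inE pb qb !orbT.
have {il} : i < size l by exact: ltnW.
elim: l i [::] v => // -[s b] l IHl [|i] p q il.
  by exists b; rewrite /= take0 !cats1 !inE !eqxx !orbT.
have [c [pc qc]] := IHl i (rcons p s) (rcons q s) il.
by exists c; rewrite !inE /= -!cat_rcons pc qc !orbT.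
Qed.

Section Subshift.
Local Open Scope group_scope.
Local Open Scope classical_set_scope.
Variables (G : groupType) (S : {fset G}) (A : finType).

Definition square_codings : set (pattern_coding S A) :=
  [set c | accepts (@square_checker (letter S) A (@inverse_letter G S))
             (@wp_oracle G S A) (encode c)].

Lemma square_codings_nonempty (x : full_shift G A) :
  (forall k (w : word S), word_value w != 1 -> ~~ repeated x (square k w)) ->
  avoiding (codified_patterns square_codings) x.
Proof.
move=> xw P [c [Cc cc cP]] [g xP].
have [v [a [l [z [def_c v1 vl1]]]]] :=
  accepts_sound (@wp_oracle_inverse G S A) Cc.
have [c' {def_c}def_c] := encode_prefix def_c.
have w1 : word_value (unzip1 l) != 1.
  by apply: contra_notN v1 => /eqP w1; move: vl1; rewrite word_value_cat w1 mulg1.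
(* Put w for [unzip1 l]. Since v w = 1, the choice k = g v turns k w p into g p, so the pairs of
   words in the coding give exactly the repetition of w at k. *)
have /negP := xw (g * word_value v) _ w1; apply.
apply/repeated_squareP => i il; rewrite size_map in il.
have [b [pb qb]] := mem_pairs v a il.
have match_c t : t \in pairs v a l -> x (g * word_value t.1) = t.2.
  by move=> tl; apply: (codified_match cc cP xP); rewrite def_c mem_cat tl.
rewrite -[g * word_value v * word_value (unzip1 l)]mulgA -word_value_cat vl1 mulg1.
by rewrite -mulgA -word_value_cat (match_c _ pb) (match_c _ qb).
Qed.

(** If g <> 1 fixes x, take words w for g and v for its inverse. The coding built from v and w with
    the colours of x is accepted, and x matches it at 1 because x(v p) = x(p). *)
Lemma square_codings_aperiodic : generates S ->
  strongly_aperiodic (avoiding (codified_patterns square_codings)).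
Proof.
move=> S_gen x xC; apply/seteqP; split=> [g /= xg|_ /= ->]; last first.
  by apply/funext => h; rewrite /shift_action invg1 mul1g.
apply: contrapT => g1; have [w wg] := S_gen g; have [v vg] := S_gen g^-1.
have x_inv h : x (g^-1 * h) = x h by rewrite -[in RHS]xg.
(* Each letter of w is paired with the colour in x of the prefix ending at it; p accumulates the
   prefix already read. *)
pose color_path := fix color_path (p w : word S) := if w is s :: w' then
  (s, x (word_value (rcons p s))) :: color_path (rcons p s) w' else [::].
have color_pathE p w' : unzip1 (color_path p w') = w'.
  by elim: w' p => //= s w' IHw p; rewrite IHw.
have match_from p q w' t : word_value q = g^-1 * word_value p ->
    t \in pairs_from p q (color_path p w') -> x (word_value t.1) = t.2.
  elim: w' p q => //= s w' IHw p q qp.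
  have qps : word_value (rcons q s) = g^-1 * word_value (rcons p s).
    by rewrite -!cats1 !word_value_cat mulgA qp.
  rewrite !inE => /or3P[/eqP-> //|/eqP-> /=|]; last exact: IHw.
  by rewrite qps x_inv.
apply: (@avoiding_mismatch _ _ _ square_codings
  (pairs v (x 1) (color_path [::] w)) x 1) => //.
  rewrite /square_codings /= -[encode _]cats0.
  apply: (accepts_complete (@wp_oracle_inverse G S A)).
    by rewrite vg => /eqP; rewrite invg_eq1 => /eqP.
  by rewrite color_pathE word_value_cat vg wg mulVg.
have nil1 : word_value ([::] : word S) = 1 by rewrite /word_value big_nil.
move=> t; rewrite mul1g !inE => /or3P[/eqP-> /=|/eqP-> /=|]; first by rewrite nil1.
  by rewrite vg -[g^-1]mulg1 x_inv.
by apply: match_from; rewrite nil1 mulg1.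
Qed.

End Subshift.

Local Open Scope classical_set_scope.

Theorem theorem2p6 (G : groupType) (S : {fset G}) (S_gen : generates S) :
  exists (A : finType) (X : set (full_shift G A)),
    [/\ is_subshift X, X !=set0, effectively_closed S X
      & strongly_aperiodic X].
Proof.
have [x simple_x] := simple_square_coloring S.
exists 'I_(8 * #|letter S|).+1, (avoiding (codified_patterns (@square_codings G S _))).
split; first exact: avoiding_subshift.
- exists x; apply: square_codings_nonempty => k w.
  exact: square_nonrepeated.
- by exists (@square_checker (letter S) _ (@inverse_letter G S)), (@square_codings G S _).
- exact: square_codings_aperiodic.
Qed.
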